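(* For every integer $d\ge1$ there exist constants $C_1=C_1(d)>0$ and $C_2=C_2(d)>0$, depending only on $d$, such that the following holds. Let $p$ be an Ising model on a graph $G=(V,E)$ with $|V|=n\ge2$, with no external field, in the $\eta$-high-temperature regime. Let $a=(a_U)$ be a real coefficient vector, not identically zero, indexed by the $d$-element subsets $U\subseteq V$, let $$f_a(x)=\sum_{U\subseteq V:\,|U|=d}a_U\prod_{u\in U}x_u,$$ and let $\|a\|_\infty=\max_{U\subseteq V:|U|=d}|a_U|$. If $X\sim p$, then for every $r\ge C_1\|a\|_\infty\,(n\log^2n/\eta)^{d/2}$, $$\Pr\left[\,|f_a(X)-\mathbf{E}[f_a(X)]|>r\,\right]\le 2\exp\left(-\frac{\eta\,r^{2/d}}{C_2\,\|a\|_\infty^{2/d}\,n\log n}\right).$$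
   Context: Let $G=(V,E)$ be a finite graph with $|V|=n$, with real parameters $(\theta_v)_{v\in V}$ and $(\theta_{uv})_{\{u,v\}\in E}$ (put $\theta_{uv}=0$ if $\{u,v\}\notin E$). The Ising model $p$ on $G$ is the probability distribution on $\{\pm1\}^V$ given by $p(x)=\exp\left(\sum_{v\in V}\theta_vx_v+\sum_{\{u,v\}\in E}\theta_{uv}x_ux_v-\Phi(\vec\theta)\right)$, where $\Phi(\vec\theta)$ is the normalizing constant. It has no external field if $\theta_v=0$ for all $v$. It is in the $\eta$-high-temperature regime (Dobrushin's uniqueness condition) if $\eta>0$ and $\max_{v\in V}\sum_{u\ne v}\tanh(|\theta_{uv}|)\le 1-\eta$. $\log$ is the natural logarithm. *)

(* Defs.v *)
From mathcomp Require Import all_boot all_order all_algebra.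
From mathcomp Require Import reals sequences exp.
Set Implicit Arguments.
Unset Strict Implicit.
Unset Printing Implicit Defensive.
Import Order.TTheory GRing.Theory Num.Theory.
Local Open Scope ring_scope.

Definition tanh (R : realType) (x : R) : R :=
  (expR x - expR (- x)) / (expR x + expR (- x)).

(* A finite simple graph on V is given by its edge set E, an edge {u, v} being
   the two-element set [set u; v]. *)
Definition simple_graph (V : finType) (E : {set {set V}}) : Prop :=
  forall e, e \in E -> #|e| = 2%N.

(* A configuration in {+1, -1}^V is stored as a boolean function on V, true
   standing for +1. *)
Definition config (V : finType) := {ffun V -> bool}.

Definition spin (R : realType) (V : finType) (x : config V) (v : V) : R :=
  if x v then 1 else -1.

Section Ising.
Variables (R : realType) (V : finType) (E : {set {set V}}).

(* Edge parameters are functions on sets of vertices of which only the values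
   on E are used; this makes theta_uv symmetric in u and v, and zero when
   {u, v} is not an edge. *)
Definition coupling (thE : {set V} -> R) (u v : V) : R :=
  if [set u; v] \in E then thE [set u; v] else 0.

(* Since edges have two elements, the product over an edge {u, v} is
   x_u * x_v. *)
Definition energy (thV : V -> R) (thE : {set V} -> R) (x : config V) : R :=
  \sum_(v : V) thV v * spin R x v
  + \sum_(e in E) thE e * \prod_(v in e) spin R x v.

Definition log_partition (thV : V -> R) (thE : {set V} -> R) : R :=
  ln (\sum_(x : config V) expR (energy thV thE x)).

Definition ising (thV : V -> R) (thE : {set V} -> R) (x : config V) : R :=
  expR (energy thV thE x - log_partition thV thE).

Definition no_external_field (thV : V -> R) : Prop := forall v, thV v = 0.

(* The maximum over v may be taken with default value 0 because all the sums
   are nonnegative. *)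
Definition high_temperature (thE : {set V} -> R) (eta : R) : Prop :=
  0 < eta /\
  \big[Num.max/0]_(v : V) (\sum_(u | u != v) tanh `|coupling thE u v|)
    <= 1 - eta.

End Ising.

(* Probability and expectation under a probability mass function p on the
   configurations. *)
Definition Pr (R : realType) (V : finType) (p : config V -> R)
    (A : pred (config V)) : R :=
  \sum_(x | A x) p x.

Definition Ex (R : realType) (V : finType) (p : config V -> R)
    (f : config V -> R) : R :=
  \sum_x p x * f x.

(* Coefficient vectors indexed by the d-element subsets are functions on all
   subsets of V of which only the values on d-element subsets are used. *)
Definition multilinear (R : realType) (V : finType) (d : nat)
    (a : {set V} -> R) (x : config V) : R :=
  \sum_(U : {set V} | #|U| == d) a U * \prod_(u in U) spin R x u.

Definition sup_norm (R : realType) (V : finType) (d : nat)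
    (a : {set V} -> R) : R :=
  \big[Num.max/0]_(U : {set V} | #|U| == d) `|a U|.

(* Main.v *)
(* Expand the powers of f_a and compare term by term, by Ginibre's inequality
   |E_theta x_U| <= E_|theta| x_U, with the ferromagnet with parameters
   |theta_e|, which satisfies the same high-temperature condition. As its spin
   monomials have nonnegative expectations (Griffiths), this gives
   E_theta f_a^k <= |a|_oo^k E_|theta| M^(dk) for the magnetization M = sum_v x_v.
   In the ferromagnet, for v outside of A,
   E x_v x_A <= sum_u tanh|theta_uv| E x_u x_A,
   which, summed over all words of length k, yields the Gaussian recursion
   eta E M^(k+1) <= n k E M^(k-1). The theorem then follows from Markov's
   inequality for a moment of order about eta (r / |a|_oo)^(2/d) / n; the
   threshold on r makes |E f_a| at most r / 2. *)
Require Import Defs.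
From mathcomp Require Import all_boot all_order all_algebra.
From mathcomp Require Import reals sequences exp.
From mathcomp Require Import ring lra.
Import Order.TTheory GRing.Theory Num.Theory.
Local Open Scope ring_scope.

(** * Spin monomials and the cone of functions with nonnegative Walsh coefficients *)

Section SpinMonomials.
Context {R : realType} {V : finType}.
Implicit Types (x y z : config V) (v : V) (w : seq V) (f g : config V -> R).

Lemma spinE x v : spin R x v = (-1) ^+ ~~ x v.
Proof. by rewrite /spin; case: (x v). Qed.

Lemma spin_sq x v : spin R x v * spin R x v = 1.
Proof. by rewrite spinE -expr2 sqrr_sign. Qed.

(** Monomials are indexed by words rather than sets, so that products become concatenations; a
    letter occurring twice cancels, since spins square to 1. *)
Definition chi w x : R := \prod_(v <- w) spin R x v.

Lemma chi_nil x : chi [::] x = 1.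
Proof. by rewrite /chi big_nil. Qed.

Lemma chi_cons v w x : chi (v :: w) x = spin R x v * chi w x.
Proof. by rewrite /chi big_cons. Qed.

Lemma chi_cat w1 w2 x : chi (w1 ++ w2) x = chi w1 x * chi w2 x.
Proof. by rewrite /chi big_cat. Qed.

Lemma chi_enum (U : {set V}) x : \prod_(v in U) spin R x v = chi (enum U) x.
Proof. by rewrite /chi big_enum. Qed.

Lemma chiE w x : chi w x = 1 \/ chi w x = -1.
Proof.
elim: w => [|v w IH]; first by left; rewrite chi_nil.
rewrite chi_cons spinE; case: IH => ->; case: (x v); rewrite /= ?expr0 ?expr1;
  rewrite ?mulr1 ?mulrN1 ?opprK; tauto.
Qed.

(** The sum factors over the vertices; a vertex of multiplicity m in [w] contributes 1 + (-1)^m,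
    which is 0 or 2. *)
Lemma sum_chi_ge0 w : 0 <= \sum_x chi w x.
Proof.
have chi_count x : chi w x = \prod_v spin R x v ^+ count_mem v w.
  elim: w => [|u w IH]; first by rewrite chi_nil big1.
  rewrite chi_cons IH (bigD1 u) //= [in RHS](bigD1 u) //= eqxx exprD expr1 mulrA.
  by congr (_ * _); apply: eq_bigr => v /negPf vu; rewrite eq_sym vu.
under eq_bigr do rewrite chi_count.
rewrite -(bigA_distr_bigA (fun v (b : bool) =>
  (if b then 1 else -1 : R) ^+ count_mem v w)).
apply: prodr_ge0 => v _; rewrite big_bool /= expr1n -signr_odd.
by case: odd; rewrite ?expr1 ?subrr // expr0 addr_ge0.
Qed.

(* Membership in the cone of functions all of whose Fourier-Walsh
   coefficients are nonnegative. *)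
Definition gpos f := forall w, 0 <= \sum_x f x * chi w x.

Lemma eq_gpos f g : f =1 g -> gpos f -> gpos g.
Proof. by move=> fg fP w; under eq_bigr do rewrite -fg. Qed.

Lemma gpos1 : gpos (fun=> 1).
Proof. by move=> w; under eq_bigr do rewrite mul1r; exact: sum_chi_ge0. Qed.

Lemma gpos_sum_ge0 f : gpos f -> 0 <= \sum_x f x.
Proof.
by move=> /(_ [::]); under eq_bigr do rewrite chi_nil mulr1.
Qed.

Lemma gpos_chi f w : gpos f -> gpos (fun x => f x * chi w x).
Proof.
move=> fP w'; under eq_bigr do rewrite -mulrA -chi_cat.
exact: fP.
Qed.

Lemma gpos_spin f v : gpos f -> gpos (fun x => f x * spin R x v).
Proof.
move=> /(@gpos_chi _ [:: v]); apply: eq_gpos => x.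
by rewrite chi_cons chi_nil mulr1.
Qed.

Lemma gpos_add f g : gpos f -> gpos g -> gpos (fun x => f x + g x).
Proof.
move=> fP gP w; under eq_bigr do rewrite mulrDl.
by rewrite big_split addr_ge0.
Qed.

Lemma gpos_scale f c : 0 <= c -> gpos f -> gpos (fun x => c * f x).
Proof.
move=> c0 fP w; under eq_bigr do rewrite -mulrA.
by rewrite -mulr_sumr mulr_ge0.
Qed.

Lemma gpos_sum (I : finType) (F : I -> config V -> R) :
  (forall i, gpos (F i)) -> gpos (fun x => \sum_i F i x).
Proof.
move=> FP w; under eq_bigr do rewrite mulr_suml.
by rewrite exchange_big sumr_ge0 // => i _; exact: FP.
Qed.

(** Each factor turns f into a nonnegative combination of f and f times a monomial, and the cone is
    stable under both operations. *)
Lemma gpos_prod (I : Type) (s : seq I) (c b : I -> R) (w : I -> seq V) f :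
    (forall i, 0 <= c i) -> (forall i, 0 <= b i) -> gpos f ->
  gpos (fun x => f x * \prod_(i <- s) (c i + b i * chi (w i) x)).
Proof.
move=> c0 b0; elim: s f => [|i s IH] f fP.
  by apply: eq_gpos fP => x; rewrite big_nil mulr1.
have /IH : gpos (fun x => f x * (c i + b i * chi (w i) x)).
  have := gpos_add _ _ (gpos_scale _ _ (c0 i) fP)
    (gpos_scale _ _ (b0 i) (gpos_chi _ (w i) fP)).
  by apply: eq_gpos => x; ring.
by apply: eq_gpos => x; rewrite big_cons mulrA.
Qed.

(* Expand the product one factor at a time: the first term is annihilated, and
   each other term is increased by restoring the factors that it lacks. *)
Lemma sum_prod_le (I : Type) (s : seq I) (c b t : I -> R) (w : I -> seq V) f :
    (forall i, 0 <= c i) -> (forall i, 0 <= b i) -> (forall i, 0 <= t i) ->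
    (forall i, b i = t i * c i) -> gpos f -> \sum_x f x = 0 ->
  \sum_x f x * \prod_(i <- s) (c i + b i * chi (w i) x) <=
  \sum_(i <- s) t i *
    \sum_x f x * chi (w i) x * \prod_(j <- s) (c j + b j * chi (w j) x).
Proof.
move=> c0 b0 t0 bE fP f0; elim: s => [|i s IH].
  by rewrite big_nil; under eq_bigr do rewrite big_nil mulr1; rewrite f0.
set P := fun x => \prod_(j <- s) (c j + b j * chi (w j) x) in IH *.
have mono g : gpos g -> c i * (\sum_x g x * P x) <=
    \sum_x g x * \prod_(j <- i :: s) (c j + b j * chi (w j) x).
  move=> gP; rewrite -subr_ge0.
  have -> : \sum_x g x * \prod_(j <- i :: s) (c j + b j * chi (w j) x) -
      c i * (\sum_x g x * P x) = b i * \sum_x g x * chi (w i) x * P x.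
    rewrite mulr_sumr -sumrB mulr_sumr; apply: eq_bigr => x _.
    by rewrite big_cons -/(P x); ring.
  rewrite mulr_ge0 //; apply: gpos_sum_ge0.
  by apply: gpos_prod => //; exact: gpos_chi.
have -> : \sum_x f x * \prod_(j <- i :: s) (c j + b j * chi (w j) x) =
    c i * (\sum_x f x * P x) + t i * (c i * \sum_x f x * chi (w i) x * P x).
  rewrite !mulr_sumr -big_split; apply: eq_bigr => x _ /=.
  by rewrite big_cons -/(P x) bE; ring.
rewrite [leRHS]big_cons addrC lerD //.
  by rewrite ler_wpM2l // mono //; exact: gpos_chi.
apply: (le_trans (ler_wpM2l (c0 i) IH)); rewrite mulr_sumr ler_sum // => j _.
by rewrite mulrCA ler_wpM2l // mono //; exact: gpos_chi.
Qed.

Definition flip v x : config V := [ffun u => if u == v then ~~ x u else x u].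

Lemma flipK v : involutive (flip v).
Proof. by move=> x; apply/ffunP => u; rewrite !ffunE; case: eqP; rewrite ?negbK. Qed.

Lemma spin_flip v u x :
  spin R (flip v x) u = if u == v then - spin R x u else spin R x u.
Proof. by rewrite /spin ffunE; case: eqP => //; case: (x u); rewrite //= opprK. Qed.

Lemma sum_flip v f : (forall x, f (flip v x) = - f x) -> \sum_x f x = 0.
Proof.
move=> fN; have /eqP : \sum_x f x = - \sum_x f x.
  rewrite {1}(reindex_inj (inv_inj (flipK v))) /= -sumrN.
  by apply: eq_bigr => x _.
by rewrite -subr_eq0 opprK -mulr2n mulrn_eq0 /= => /eqP.
Qed.

Lemma chi_flip v w x : v \notin w -> chi w (flip v x) = chi w x.
Proof.
move=> vw; apply: eq_big_seq => u uw; rewrite spin_flip; case: eqP => // uv.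
by rewrite -uv uw in vw.
Qed.

End SpinMonomials.

(** * Gibbs weights and the comparison with the ferromagnet *)

Section GibbsWeights.
Context {R : realType} {V : finType} (E : {set {set V}}).
Implicit Types (x y z : config V) (v : V) (w : seq V) (J : {set V} -> R).
Implicit Types (f g : config V -> R).

Definition weight J x : R :=
  expR (\sum_(e in E) J e * \prod_(v in e) spin R x v).

(** This is the unnormalized expectation; [gsum J (fun=> 1)] is the partition function. Inequalities
    between expectations are stated cross-multiplied. *)
Definition gsum J g : R := \sum_x weight J x * g x.

Lemma weight_gt0 J x : 0 < weight J x.
Proof. exact: expR_gt0. Qed.

Lemma gsum1_gt0 J : 0 < gsum J (fun=> 1).
Proof.
rewrite /gsum; under eq_bigr do rewrite mulr1.
rewrite (bigD1 [ffun=> true]) //=; apply: ltr_wpDr; last exact: weight_gt0.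
by apply: sumr_ge0 => x _; exact/ltW/weight_gt0.
Qed.

Lemma eq_gsum J f g : f =1 g -> gsum J f = gsum J g.
Proof. by move=> fg; apply: eq_bigr => x _; rewrite fg. Qed.

Lemma gsum_sum J (I : finType) (P : pred I) (F : I -> config V -> R) :
  gsum J (fun x => \sum_(i | P i) F i x) = \sum_(i | P i) gsum J (F i).
Proof. by rewrite exchange_big; apply: eq_bigr => x _; rewrite mulr_sumr. Qed.

Lemma gsumZ J c g : gsum J (fun x => c * g x) = c * gsum J g.
Proof. by rewrite /gsum mulr_sumr; apply: eq_bigr => x _; rewrite mulrCA. Qed.

Definition cosh (t : R) : R := (expR t + expR (- t)) / 2.
Definition sinh (t : R) : R := (expR t - expR (- t)) / 2.

Lemma cosh_gt0 t : 0 < cosh t.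
Proof. by rewrite divr_gt0 // addr_gt0 // expR_gt0. Qed.

Lemma sinh_ge0 t : 0 <= t -> 0 <= sinh t.
Proof.
by move=> t0; rewrite divr_ge0 // subr_ge0 ler_expR (le_trans _ t0) // oppr_le0.
Qed.

Lemma sinhE t : sinh t = tanh t * cosh t.
Proof.
rewrite /sinh /tanh /cosh; field.
by rewrite gt_eqF // addr_gt0 // expR_gt0.
Qed.

Lemma tanh_ge0 (t : R) : 0 <= t -> 0 <= tanh t.
Proof.
by move=> t0; rewrite -(pmulr_lge0 _ (cosh_gt0 t)) -sinhE sinh_ge0.
Qed.

(** A function of the sign [chi w x] is affine in it. This gives the edge factors the form c + b chi
    of [gpos_prod], with b = c tanh t. *)
Lemma expR_chi t w x : expR (t * chi w x) = cosh t + sinh t * chi w x.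
Proof.
by rewrite /cosh /sinh; case: (chiE (R := R) w x) => ->;
  rewrite ?mulr1 ?mulrN1; field.
Qed.

Lemma prod_expR_chi (s : seq {set V}) J x :
  \prod_(e <- s) expR (J e * chi (enum e) x) =
  \prod_(e <- s) (cosh (J e) + sinh (J e) * chi (enum e) x).
Proof. by apply: eq_bigr => e _; rewrite expR_chi. Qed.

Lemma weight_prod J x :
  weight J x = \prod_(e <- enum E) expR (J e * chi (enum e) x).
Proof.
by rewrite /weight expR_sum big_enum; apply: eq_bigr => e _; rewrite chi_enum.
Qed.

Lemma gpos_expR (s : seq {set V}) J f : (forall e, 0 <= J e) -> gpos f ->
  gpos (fun x => f x * \prod_(e <- s) expR (J e * chi (enum e) x)).
Proof.
move=> J0 fP.
apply: (eq_gpos _ _ _ (gpos_prod _ s (fun e => cosh (J e)) (fun e => sinh (J e))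
  (fun e => enum e) f _ _ fP)) => [x|e|e].
- by rewrite prod_expR_chi.
- exact/ltW/cosh_gt0.
- exact/sinh_ge0.
Qed.

Lemma gpos_weight J : (forall e, 0 <= J e) -> gpos (weight J).
Proof.
move=> J0; apply: eq_gpos (gpos_expR (enum E) J (fun=> 1) J0 gpos1) => x.
by rewrite mul1r weight_prod.
Qed.

(* Ginibre's duplicate variable argument: after the substitution y = x z the
   pair of weights becomes, for each fixed z, a single weight with the
   nonnegative parameters |J_e| + J_e z_e. *)
Lemma ginibre J w (s : bool) :
  (-1) ^+ s * gsum J (chi w) * gsum (fun e => `|J e|) (fun=> 1) <=
  gsum J (fun=> 1) * gsum (fun e => `|J e|) (chi w).
Proof.
set K := fun e => `|J e|.
pose m x z : config V := [ffun v => x v == z v].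
have mK x : involutive (m x).
  by move=> z; apply/ffunP => v; rewrite !ffunE; case: (x v); case: (z v).
have chi_m w' x z : chi w' (m x z) = chi w' x * chi w' z :> R.
  rewrite /chi -big_split; apply: eq_bigr => v _ /=.
  rewrite /spin ffunE; case: (x v); case: (z v) => /=;
    by rewrite ?mulr1 ?mul1r ?mulrNN ?mulr1.
rewrite -subr_ge0.
have -> : gsum J (fun=> 1) * gsum K (chi w) -
    (-1) ^+ s * gsum J (chi w) * gsum K (fun=> 1) =
    \sum_x \sum_y weight K x * weight J y * (chi w x - (-1) ^+ s * chi w y).
  rewrite -(gsumZ J) [X in X - _]mulrC [X in _ - X]mulrC /gsum !big_distrlr /= -sumrB.
  apply: eq_bigr => x _; rewrite -sumrB; apply: eq_bigr => y _.
  ring.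
under eq_bigr => x _ do rewrite (reindex_inj (inv_inj (mK x))) /=.
rewrite exchange_big sumr_ge0 //= => z _.
have -> : \sum_x weight K x * weight J (m x z) *
      (chi w x - (-1) ^+ s * chi w (m x z)) =
    (1 - (-1) ^+ s * chi w z) *
    \sum_x weight (fun e => K e + J e * chi (enum e) z) x * chi w x.
  rewrite mulr_sumr; apply: eq_bigr => x _.
  have -> : weight K x * weight J (m x z) =
      weight (fun e => K e + J e * chi (enum e) z) x.
    rewrite /weight -expRD -big_split; congr expR; apply: eq_bigr => e _ /=.
    by rewrite !chi_enum chi_m; ring.
  by rewrite chi_m; ring.
(* The first factor is 0 or 2; the second is a ferromagnetic sum of a monomial. *)
apply: mulr_ge0.
  by case: s; case: (chiE (R := R) w z) => ->; rewrite ?expr0 ?expr1; lra.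
apply: gpos_weight => e; rewrite /K.
have := ler_norm (J e); have := lerNnormlW (lexx `|J e|).
by case: (chiE (R := R) (enum e) z) => ->; lra.
Qed.

(** Both signs in [ginibre] together bound the absolute value. *)
Lemma norm_gsum_chi J w :
  `|gsum J (chi w)| * gsum (fun e => `|J e|) (fun=> 1) <=
  gsum J (fun=> 1) * gsum (fun e => `|J e|) (chi w).
Proof.
have [_|_] := ger0P (gsum J (chi w)).
  by have := ginibre J w false; rewrite expr0 mul1r.
by have := ginibre J w true; rewrite expr1 mulN1r.
Qed.

End GibbsWeights.

(** * Correlation inequalities in a ferromagnet at high temperature *)

Section HighTemperature.
Context {R : realType} {V : finType} (E : {set {set V}}).
Hypothesis simpleE : simple_graph E.
Variables (J : {set V} -> R) (eta : R).
Hypothesis J_ge0 : forall e, 0 <= J e.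
Hypothesis J_small :
  forall v, \sum_(u | u != v) tanh `|coupling E J v u| <= 1 - eta.
Implicit Types (x y z : config V) (u v : V) (w : seq V).
Implicit Types (f g : config V -> R).

Local Notation S := (gsum E J).
Local Notation T v u := (tanh `|coupling E J v u|).

Lemma sum_edges_at v (F : {set V} -> R) :
  \sum_(e in E | v \in e) F e = \sum_(u | (u != v) && ([set v; u] \in E)) F [set v; u].
Proof.
(* [h] recovers the endpoint of an edge other than v; its default value is never reached on an edge
   containing v. *)
pose h (e : {set V}) := odflt v [pick u in e :\ v].
rewrite (reindex_onto (fun u => [set v; u]) h) /=; last first.
  move=> e /andP[/simpleE e2 ve]; rewrite /h.
  have /cards1P[u eu] : #|e :\ v| == 1%N.
    by move: e2; rewrite (cardsD1 v) ve => /eqP.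
  case: pickP => [u'|/(_ u)]; last by rewrite eu inE eqxx.
  by rewrite eu inE => /eqP -> /=; rewrite -(setD1K ve) eu.
apply: eq_bigl => u; rewrite !inE eqxx /= andbT andbC.
have [uE|] := boolP ([set v; u] \in E); rewrite ?andbF // !andbT.
have uv : u != v.
  by apply: contraTneq uE => ->; apply/negP => /simpleE; rewrite setUid cards1.
rewrite uv /h.
case: pickP => [u'|/(_ u)]; last by rewrite !inE eqxx uv orbT.
by rewrite !inE => /andP[/negPf -> /eqP ->] /=; rewrite eqxx.
Qed.

Lemma tanh_norm_coupling u v :
  T v u = if [set v; u] \in E then tanh (J [set v; u]) else 0.
Proof.
rewrite /coupling; case: ifP => _; first by rewrite ger0_norm.
by rewrite normr0 /tanh oppr0 subrr mul0r.
Qed.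

Lemma weight_split v x :
  weight E J x =
  \prod_(e <- enum [pred e in E | v \notin e]) expR (J e * chi (enum e) x) *
  \prod_(e <- enum [pred e in E | v \in e]) expR (J e * chi (enum e) x).
Proof.
rewrite weight_prod !big_enum /= (bigID (fun e : {set V} => v \notin e)) /=.
by congr (_ * _); apply: eq_bigl => e; rewrite !inE ?negbK.
Qed.

(** Only the edges at v are expanded, by [sum_prod_le] with ratios tanh J_e. An edge {v, u}
    multiplies x_v x_w by x_v x_u, which leaves x_u x_w. *)
Lemma gsum_step v w : v \notin w ->
  S (chi (v :: w)) <= \sum_(u | u != v) T v u * S (chi (u :: w)).
Proof.
move=> vw; pose f x : R :=
  \prod_(e <- enum [pred e in E | v \notin e]) expR (J e * chi (enum e) x) *
  chi (v :: w) x.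
have fP : gpos f.
  apply: gpos_chi; apply: eq_gpos (gpos_expR (enum [pred e in E | v \notin e])
    J (fun=> 1) J_ge0 gpos1) => x.
  by rewrite mul1r.
(* Neither the remaining edges nor w contain v, so flipping v changes the sign of f. *)
have f0 : \sum_x f x = 0.
  apply: (sum_flip v) => x; rewrite /f !chi_cons chi_flip // spin_flip eqxx.
  rewrite mulNr mulrN; congr (- (_ * _)).
  rewrite !big_enum; apply: eq_bigr => e /andP[_ ve].
  by rewrite chi_flip // mem_enum.
have SE g : S (fun x => chi (v :: w) x * g x) =
    \sum_x f x * g x * \prod_(e <- enum [pred e in E | v \in e])
      (cosh (J e) + sinh (J e) * chi (enum e) x).
  apply: eq_bigr => x _; rewrite (weight_split v).
  by rewrite (prod_expR_chi (enum [pred e in E | v \in e])) /f; ring.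
have -> : S (chi (v :: w)) = S (fun x => chi (v :: w) x * 1).
  by apply: eq_gsum => x; rewrite mulr1.
rewrite SE; under eq_bigr do rewrite mulr1.
apply: (le_trans (sum_prod_le _ _ _ _ (fun e => tanh (J e)) _ _ _ _ _ _ fP f0)).
- by move=> e; exact/ltW/cosh_gt0.
- by move=> e; exact/sinh_ge0.
- by move=> e; exact/tanh_ge0.
- by move=> e; rewrite sinhE.
rewrite big_enum /=.
under eq_bigr do rewrite -SE.
rewrite (sum_edges_at v) big_mkcondr /=; apply: ler_sum => u uv.
rewrite tanh_norm_coupling; case: ifP => _; last by rewrite mul0r.
rewrite (eq_gsum _ _ _ (chi (u :: w))) // => x.
rewrite -chi_enum big_setU1 ?inE 1?eq_sym // big_set1 !chi_cons.
by rewrite mulrACA mulrA spin_sq mul1r mulrC.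
Qed.

(** * Moments of the magnetization *)

Definition mag x : R := \sum_v spin R x v.

Lemma gpos_magX f k : gpos f -> gpos (fun x => f x * mag x ^+ k).
Proof.
move=> fP; elim: k => [|k IH]; first by apply: eq_gpos fP => x; rewrite mulr1.
have := gpos_sum _ _ (fun v => gpos_spin _ v IH).
by apply: eq_gpos => x; rewrite -mulr_sumr exprSr mulrA.
Qed.

Lemma gsum_mag_ge0 k w : 0 <= S (fun x => mag x ^+ k * chi w x).
Proof.
apply: (le_trans (gpos_magX _ k (gpos_weight E J J_ge0) w)).
by rewrite le_eqVlt; apply/orP; left; apply/eqP/eq_bigr => x _; rewrite mulrA.
Qed.

Lemma gsum_magS k w :
  S (fun x => mag x ^+ k.+1 * chi w x) =
  \sum_v S (fun x => mag x ^+ k * chi (v :: w) x).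
Proof.
rewrite -gsum_sum; apply: eq_gsum => x.
rewrite exprSr -mulrA -mulr_sumr; congr (_ * _).
by rewrite mulr_suml; apply: eq_bigr => v _; rewrite chi_cons.
Qed.

(** By induction on k, one factor of the magnetization is expanded into letters y. For y != v the
    word y :: w still avoids v, so the induction hypothesis applies; the letter y = v cancels x_v
    and accounts for one of the k lower-order terms. *)
Lemma gsum_mag_step k v w : v \notin w ->
  S (fun x => mag x ^+ k * chi (v :: w) x) <=
  \sum_(u | u != v) T v u * S (fun x => mag x ^+ k * chi (u :: w) x) +
  k%:R * S (fun x => mag x ^+ k.-1 * chi w x).
Proof.
have swap j u u' w' : S (fun x => mag x ^+ j * chi [:: u, u' & w'] x) =
    S (fun x => mag x ^+ j * chi [:: u', u & w'] x).
  by apply: eq_gsum => x; rewrite !chi_cons [spin R x u * _]mulrCA.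
elim: k w => [|k IH] w vw.
  rewrite mul0r addr0 (eq_gsum _ _ _ (chi (v :: w))) => [|x]; last by rewrite mul1r.
  apply: (le_trans (gsum_step _ _ vw)); rewrite le_eqVlt; apply/orP; left.
  by apply/eqP/eq_bigr => u _; congr (_ * _); apply: eq_gsum => x; rewrite mul1r.
rewrite gsum_magS (bigD1 v) //= addrC.
have -> : S (fun x => mag x ^+ k * chi [:: v, v & w] x) =
    S (fun x => mag x ^+ k * chi w x).
  by apply: eq_gsum => x; rewrite !chi_cons [spin R x v * _]mulrA spin_sq mul1r.
rewrite -natr1 mulrDl mul1r addrA lerD2r.
under eq_bigr do rewrite swap.
apply: (le_trans (y := \sum_(y | y != v)
    (\sum_(u | u != v) T v u * S (fun x => mag x ^+ k * chi [:: u, y & w] x) +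
    k%:R * S (fun x => mag x ^+ k.-1 * chi (y :: w) x)))).
  by apply: ler_sum => y yv; apply: IH; rewrite inE negb_or eq_sym yv.
(* The sums over y != v are completed by the nonnegative term y = v, which restores a full factor
   [mag]. *)
rewrite big_split /= exchange_big /= lerD //.
  apply: ler_sum => u uv; rewrite gsum_magS -mulr_sumr.
  rewrite ler_wpM2l ?tanh_ge0 // [leRHS](bigD1 v) //= ler_wpDl ?gsum_mag_ge0 //.
  by under eq_bigr do rewrite swap.
(* For k = 0 the truncated exponent [k.-1] is harmless, because its coefficient vanishes. *)
rewrite -mulr_sumr; case: k {IH} => [|k]; first by rewrite !mul0r.
by rewrite ler_wpM2l // gsum_magS [leRHS](bigD1 v) //= ler_wpDl ?gsum_mag_ge0.
Qed.

(** A discrete form of Gaussian integration by parts: [gsum_mag_step] with the empty word is summed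
    over v, and the resulting multiple 1 - eta of the left-hand moment is absorbed. *)
Lemma gsum_mag_rec k :
  eta * S (fun x => mag x ^+ k.+1) <=
  #|V|%:R * k%:R * S (fun x => mag x ^+ k.-1).
Proof.
have nilE j : S (fun x => mag x ^+ j) = S (fun x => mag x ^+ j * chi [::] x).
  by apply: eq_gsum => x; rewrite chi_nil mulr1.
rewrite !nilE.
suff : S (fun x => mag x ^+ k.+1 * chi [::] x) <=
    (1 - eta) * S (fun x => mag x ^+ k.+1 * chi [::] x) +
    #|V|%:R * k%:R * S (fun x => mag x ^+ k.-1 * chi [::] x) by lra.
rewrite gsum_magS.
apply: (le_trans (y := \sum_v
    (\sum_(u | u != v) T v u * S (fun x => mag x ^+ k * chi (u :: [::]) x) +
    k%:R * S (fun x => mag x ^+ k.-1 * chi [::] x)))).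
  by apply: ler_sum => v _; exact: gsum_mag_step.
rewrite big_split /= lerD //; last first.
  by rewrite sumr_const -mulrA -[leLHS]mulr_natl.
(* After the exchange the couplings are summed over v for fixed u; by symmetry this is again a
   high-temperature sum, at u. *)
rewrite (exchange_big_dep predT) //= mulr_sumr; apply: ler_sum => u _.
rewrite -mulr_suml ler_wpM2r ?gsum_mag_ge0 //.
apply: le_trans (J_small u); rewrite le_eqVlt; apply/orP; left; apply/eqP.
apply: eq_big => v; first by rewrite eq_sym.
by rewrite /coupling setUC.
Qed.

Hypothesis eta_gt0 : 0 < eta.

(** The recursion lowers the moment by two at the cost of a factor (m - 1) n / eta, which is at most
    B^2. *)
Lemma gsum_magX_le (B : R) (m : nat) : 0 <= B ->
  m%:R * (#|V|%:R / eta) <= B ^+ 2 ->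
  S (fun x => mag x ^+ m) <= B ^+ m * S (fun=> 1).
Proof.
move=> B0; have S1 := gsum1_gt0 E J.
elim/ltn_ind: m => -[|[|m]] IH mB.
- by rewrite expr0 mul1r (eq_gsum _ _ _ (fun=> 1)).
(* At k = 0 the recursion bounds the first moment by 0. *)
- have := gsum_mag_rec 0; rewrite mulr0 mul0r pmulr_rle0 // => /le_trans; apply.
  by rewrite mulr_ge0 ?exprn_ge0 // ltW.
have := gsum_mag_rec m.+1; rewrite mulrC -ler_pdivlMr // => /le_trans; apply.
have n0 : 0 <= #|V|%:R / eta :> R by rewrite divr_ge0 // ltW.
have IHm : S (fun x => mag x ^+ m) <= B ^+ m * S (fun=> 1).
  by apply: IH => //; apply: le_trans mB; rewrite ler_wpM2r // ler_nat ltnW.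
have mag0 : 0 <= S (fun x => mag x ^+ m).
  by have := gsum_mag_ge0 m [::]; under eq_gsum do rewrite chi_nil mulr1.
have -> : #|V|%:R * m.+1%:R * S (fun x => mag x ^+ m.+1.-1) / eta =
    m.+1%:R * (#|V|%:R / eta) * S (fun x => mag x ^+ m) by rewrite /=; ring.
rewrite (exprD B 2 m) -[leRHS]mulrA ler_pM ?(mulr_ge0 _ n0) //.
by apply: le_trans mB; rewrite ler_wpM2r // ler_nat.
Qed.

End HighTemperature.

(** * Moments of the multilinear form and Markov's inequality *)

Section Moments.
Context {R : realType} {V : finType} (E : {set {set V}}).
Hypothesis simpleE : simple_graph E.
Variables (thV : V -> R) (thE : {set V} -> R) (eta : R).
Hypothesis noField : no_external_field thV.
Hypothesis highT : high_temperature E thE eta.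
Variables (d : nat) (a : {set V} -> R).
Implicit Types (w : seq V) (g : config V -> R).

Local Notation K := (fun e => `|thE e|).
Local Notation A := (sup_norm d a).
Local Notation p := (ising E thV thE).
Local Notation f := (multilinear d a).

Lemma sup_norm_ge (U : {set V}) : #|U| == d -> `|a U| <= A.
Proof. by move=> Ud; apply: (le_bigmax_cond _ (fun U => `|a U|)). Qed.

Lemma sup_norm_ge0 : 0 <= A.
Proof. exact: bigmax_ge_id. Qed.

Lemma mag_prod k (x : config V) :
  mag x ^+ k = \sum_(s : {ffun 'I_k -> V}) \prod_i spin R x (s i).
Proof.
by rewrite -(bigA_distr_bigA (fun _ v => spin R x v)) prodr_const card_ord.
Qed.

(** The power [mag x ^+ d] is a sum over words of length d, all with nonnegative contributions; the
    words are grouped by their image, and a d-set keeps only the word that enumerates it. *)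
Lemma sum_gsum_sets_le k w :
  \sum_(U : {set V} | #|U| == d) gsum E K (fun x => mag x ^+ k * chi (enum U ++ w) x)
  <= gsum E K (fun x => mag x ^+ (d + k) * chi w x).
Proof.
pose F (s : {ffun 'I_d -> V}) : R :=
  gsum E K (fun x => mag x ^+ k * chi ([seq s i | i <- enum 'I_d] ++ w) x).
have F0 s : 0 <= F s by apply: gsum_mag_ge0.
have FE (s : {ffun 'I_d -> V}) x :
    chi [seq s i | i <- enum 'I_d] x = \prod_i spin R x (s i).
  by rewrite /chi big_map big_enum.
have -> : gsum E K (fun x => mag x ^+ (d + k) * chi w x) = \sum_s F s.
  rewrite -gsum_sum; apply: eq_gsum => x.
  under eq_bigr do rewrite chi_cat FE mulrCA.
  by rewrite exprD mag_prod -mulr_suml mulrA.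
rewrite (partition_big (fun s : {ffun 'I_d -> V} => [set s i | i : 'I_d]) predT) //=.
rewrite [leLHS]big_mkcond; apply: ler_sum => U _ /=.
case: ifP => [Ud|_]; last by rewrite sumr_ge0.
have sU : size (enum U) == d by rewrite -cardE.
pose s : {ffun 'I_d -> V} := finfun (tnth (Tuple sU)).
rewrite (bigD1 s) /=; last first.
  apply/eqP/setP => v; apply/imsetP/idP => [[i _ ->]|].
    by rewrite ffunE -mem_enum -[enum U]/(val (Tuple sU)) mem_tnth.
  rewrite -mem_enum -[enum U]/(val (Tuple sU)) => /tnthP[i ->].
  by exists i => //; rewrite ffunE.
apply: ler_wpDr; first by rewrite sumr_ge0.
rewrite le_eqVlt; apply/orP; left; apply/eqP/eq_gsum => x.
rewrite !chi_cat FE; congr (_ * (_ * _)).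
rewrite /chi -[enum U]/(val (Tuple sU)) big_tuple.
by apply: eq_bigr => i _; rewrite ffunE.
Qed.

(* Expanding the power and comparing term by term, by Ginibre's inequality,
   with the ferromagnet with parameters |theta_e|, in which all the
   expectations of spin monomials are nonnegative. *)
Lemma gsum_multilinearX k w :
  `|gsum E thE (fun x => f x ^+ k * chi w x)| * gsum E K (fun=> 1) <=
  A ^+ k * gsum E thE (fun=> 1) * gsum E K (fun x => mag x ^+ (d * k) * chi w x).
Proof.
have Zth := gsum1_gt0 E thE; have ZK := gsum1_gt0 E K.
(* The word w stays general, to absorb the monomial split off from f. *)
elim: k w => [|k IH] w.
  rewrite muln0 mul1r; under eq_gsum do rewrite mul1r.
  by under [X in _ <= _ * X]eq_gsum do rewrite mul1r; exact: norm_gsum_chi.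
have -> : gsum E thE (fun x => f x ^+ k.+1 * chi w x) =
    \sum_(U : {set V} | #|U| == d)
      a U * gsum E thE (fun x => f x ^+ k * chi (enum U ++ w) x).
  under [RHS]eq_bigr do rewrite -gsumZ.
  rewrite -gsum_sum; apply: eq_gsum => x.
  rewrite exprSr -mulrA [f x * _]mulr_suml mulr_sumr; apply: eq_bigr => U _.
  by rewrite chi_cat chi_enum; ring.
apply: le_trans (ler_wpM2r (ltW ZK) (ler_norm_sum _ _ _)) _.
rewrite mulr_suml.
apply: (le_trans (y := \sum_(U : {set V} | #|U| == d) A ^+ k.+1 *
    gsum E thE (fun=> 1) * gsum E K (fun x => mag x ^+ (d * k) * chi (enum U ++ w) x))).
  apply: ler_sum => U Ud; rewrite normrM exprS -!mulrA.
  apply: ler_pM; rewrite ?mulr_ge0 ?(ltW ZK) ?sup_norm_ge //.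
  by rewrite mulrA; exact: IH.
rewrite -mulr_sumr ler_wpM2l ?mulr_ge0 ?exprn_ge0 ?sup_norm_ge0 ?(ltW Zth) //.
by rewrite mulnS; exact: sum_gsum_sets_le.
Qed.

Lemma isingE x : p x = weight E thE x / gsum E thE (fun=> 1).
Proof.
have enE y : energy E thV thE y =
    \sum_(e in E) thE e * \prod_(v in e) spin R y v.
  by rewrite /energy big1 ?add0r // => v _; rewrite noField mul0r.
rewrite /ising /log_partition expRD expRN enE -/(weight E thE x).
have ZE : \sum_y expR (energy E thV thE y) = gsum E thE (fun=> 1).
  by apply: eq_bigr => y _; rewrite enE mulr1.
by rewrite ZE lnK // posrE gsum1_gt0.
Qed.

Lemma Ex_isingE g : Ex p g = gsum E thE g / gsum E thE (fun=> 1).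
Proof.
by rewrite /Ex /gsum mulr_suml; apply: eq_bigr => x _; rewrite isingE mulrAC.
Qed.

Lemma norm_Ex_multilinearX (B : R) k : 0 <= B ->
  (d * k)%:R * (#|V|%:R / eta) <= B ^+ 2 ->
  `|Ex p (fun x => f x ^+ k)| <= A ^+ k * B ^+ (d * k).
Proof.
move=> B0 dB; have [eta0 /bigmax_leP[_ small]] := highT.
have Zth := gsum1_gt0 E thE; have ZK := gsum1_gt0 E K.
rewrite Ex_isingE normrM normfV (gtr0_norm Zth) ler_pdivrMr //.
rewrite -(ler_pM2r ZK).
have := gsum_multilinearX k [::].
under eq_gsum do rewrite chi_nil mulr1.
under [X in _ <= _ * X]eq_gsum do rewrite chi_nil mulr1.
move=> /le_trans; apply.
(* Passing to |theta_e| leaves each |theta_uv|, hence the high-temperature sum, unchanged. *)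
have K_small v : \sum_(u | u != v) tanh `|coupling E K v u| <= 1 - eta.
  apply: le_trans (small v isT); rewrite le_eqVlt; apply/orP; left; apply/eqP.
  by apply: eq_bigr => u _; rewrite /coupling setUC; case: ifP => _; rewrite ?normr_id.
have magK := gsum_magX_le E simpleE K eta (fun e => normr_ge0 _) K_small eta0 B
  (d * k) B0 dB.
apply: le_trans (ler_wpM2l _ magK) _.
  by apply: mulr_ge0; [exact/exprn_ge0/sup_norm_ge0 | exact: ltW].
by rewrite le_eqVlt; apply/orP; left; apply/eqP; ring.
Qed.

(** Markov's inequality is applied to the uncentered even power of f: the condition on [b] gives |E
    f| <= r / 2, so that a deviation above r forces |f| >= r / 2. The condition on [B] controls the
    moment of order 2k. *)
Lemma Pr_deviation_le (r B b : R) k : 0 < r -> 0 <= B -> 0 <= b ->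
    d%:R * (#|V|%:R / eta) <= b ^+ 2 -> A * b ^+ d <= r / 2 ->
    (d * k.*2)%:R * (#|V|%:R / eta) <= B ^+ 2 ->
  Pr p (fun x => r < `|f x - Ex p f|) * (r / 2) ^+ k.*2 <=
  A ^+ k.*2 * B ^+ (d * k.*2).
Proof.
move=> r0 B0 b0 db br dB.
have p0 x : 0 <= p x by rewrite expR_ge0.
have mean : `|Ex p f| <= r / 2.
  by have := norm_Ex_multilinearX b 1 b0; rewrite muln1 => /(_ db) /le_trans; apply.
apply: le_trans (norm_Ex_multilinearX B k.*2 B0 dB).
apply: le_trans (ler_norm _).
rewrite /Pr mulr_suml /Ex big_mkcond; apply: ler_sum => x _.
have fX : 0 <= f x ^+ k.*2 by rewrite -muln2 exprM sqr_ge0.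
case: ifP => [rf|_]; last by rewrite mulr_ge0.
rewrite ler_wpM2l // -(ger0_norm fX) normrX lerXn2r ?nnegrE ?divr_ge0 ?(ltW r0) //.
have := ler_normB (f x) (Ex p f); lra.
Qed.

End Moments.

(** * Choice of the constants and of the order of the moment *)

Theorem theorem5 (R : realType) (d : nat) (hd : (1 <= d)%N) :
  exists C1 C2 : R, 0 < C1 /\ 0 < C2 /\
  forall (V : finType) (n : nat) (E : {set {set V}})
    (thV : V -> R) (thE : {set V} -> R) (eta : R) (a : {set V} -> R),
  #|V| = n -> (2 <= n)%N ->
  simple_graph E ->
  no_external_field thV ->
  high_temperature E thE eta ->
  (exists U : {set V}, #|U| = d /\ a U <> 0) ->
  forall r : R,
  C1 * sup_norm d a * powR (n%:R * ln n%:R ^+ 2 / eta) (d%:R / 2) <= r ->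
  let p := ising E thV thE in
  let f := multilinear d a in
  Pr p (fun x => r < `|f x - Ex p f|)
    <= 2 * expR (- (eta * powR r (2 / d%:R) /
                    (C2 * powR (sup_norm d a) (2 / d%:R) * n%:R * ln n%:R))).
Proof.
set e := expR 1 : R; set l := ln 2 : R.
have d0 : 0 < d%:R :> R by rewrite ltr0n.
have e0 : 0 < e by exact: expR_gt0.
have e1 : 1 <= e by rewrite -expR0 ler_expR.
have l0 : 0 < l by rewrite ln_gt0 // ltr1n.
set c := Num.sqrt (2 * e * d%:R).
have c0 : 0 < c by rewrite sqrtr_gt0 !mulr_gt0.
(* Dividing by l = ln 2 <= ln n trades logarithms for constants. In 16, one factor 4 bounds 2^(2/d),
   and the other combines the 2 in the denominator of [t] with the 2 lost by truncating [t]. *)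
exists (2 * (c / l) ^+ d), (16 * e / l).
split; first by rewrite mulr_gt0 // exprn_gt0 // divr_gt0.
split; first by rewrite divr_gt0 // mulr_gt0.
move=> V n E thV thE eta a Vn n2 simpleE noField highT [U [Ud aU]] r.
set A := sup_norm d a; set L := ln n%:R => rC; cbv zeta.
set p := ising E thV thE; set f := multilinear d a.
have eta0 : 0 < eta by case: highT.
have n0 : 0 < n%:R :> R by rewrite ltr0n ltnW.
have lL : l <= L by rewrite ler_ln ?posrE ?ltr0n ?ler_nat // ltnW.
have L0 : 0 < L by exact: lt_le_trans lL.
have A0 : 0 < A.
  by apply: lt_le_trans (sup_norm_ge d a U _); rewrite ?normr_gt0 ?Ud //; exact/eqP.
set s : R := n%:R / eta.
have s0 : 0 < s by rewrite divr_gt0.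
have powX (y : R) : 0 <= y -> powR (y ^+ d) (2 / d%:R) = y ^+ 2.
  move=> y0; rewrite -powR_mulrn // -powRrM mulrC divfK ?gt_eqF //.
  by rewrite powR_mulrn.
have y0 : 0 < Num.sqrt s * L by rewrite mulr_gt0 // sqrtr_gt0.
have rC' : 2 * (c / l) ^+ d * A * (Num.sqrt s * L) ^+ d <= r.
  apply: le_trans rC; rewrite le_eqVlt; apply/orP; left; apply/eqP.
  congr (_ * _).
  have -> : n%:R * L ^+ 2 / eta = (Num.sqrt s * L) ^+ 2.
    by rewrite exprMn sqr_sqrtr ?ltW // /s; ring.
  rewrite -(powR_mulrn 2 (ltW y0)) -powRrM mulrCA divff ?pnatr_eq0 // mulr1.
  by rewrite powR_mulrn // ltW.
have r0 : 0 < r.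
  by apply: lt_le_trans rC'; rewrite !mulr_gt0 ?exprn_gt0 ?divr_gt0.
(* The scale at which A rho^d = r / 2. *)
set rho := powR (r / (2 * A)) (d%:R^-1).
have rho0 : 0 < rho by rewrite powR_gt0 // divr_gt0 // mulr_gt0.
have rhoX : rho ^+ d = r / (2 * A).
  rewrite -powR_mulrn ?ltW // -powRrM mulVf ?gt_eqF // powRr1 //.
  by rewrite divr_ge0 ?mulr_ge0 ?ltW.
have rE : r = 2 * A * rho ^+ d by rewrite rhoX; field; rewrite gt_eqF.
(* The threshold on r, rewritten in terms of rho; it makes [t] at least 1. *)
have rho_ge : 2 * e * d%:R * s <= rho ^+ 2.
  have : c / l * (Num.sqrt s * L) <= rho.
    have cs0 : 0 <= c / l * (Num.sqrt s * L) by rewrite ltW // mulr_gt0 ?divr_gt0.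
    rewrite -(ler_pXn2r hd) ?nnegrE ?(ltW rho0) //.
    rewrite exprMn -(ler_pM2l (mulr_gt0 (ltr0Sn R 1) A0)) -rE.
    by apply: le_trans rC'; rewrite le_eqVlt; apply/orP; left; apply/eqP; ring.
  have : c * Num.sqrt s <= c / l * (Num.sqrt s * L).
    rewrite [leRHS]mulrACA ler_peMr //.
      by rewrite mulr_ge0 ?sqrtr_ge0.
    by rewrite mulrC ler_pdivlMr ?mul1r.
  move=> /le_trans le1 /le1 cs.
  have <- : (c * Num.sqrt s) ^+ 2 = 2 * e * d%:R * s.
    by rewrite exprMn !sqr_sqrtr ?ltW // !mulr_gt0.
  by rewrite lerXn2r ?nnegrE ?(ltW rho0) ?mulr_ge0 ?sqrtr_ge0.
set t := rho ^+ 2 / (2 * e * d%:R * s).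
have den0 : 0 < 2 * e * d%:R * s.
  by apply: mulr_gt0 s0; apply: mulr_gt0 d0; exact: mulr_gt0.
have t1 : 1 <= t by rewrite ler_pdivlMr // mul1r.
(* The largest k with 2 d k s <= rho^2 / e, as the moment bound with [B] requires. *)
set k := Num.trunc t.
have /andP[kt tk] : k%:R <= t < k.+1%:R.
  by apply: Num.Theory.truncn_itv; apply: le_trans t1.
have tk2 : t / 2 <= k%:R.
  have k1 : 1 <= k%:R :> R.
    by rewrite ler1n lt0n; apply: contraTneq tk => ->; rewrite -leNgt.
  by move: tk; rewrite -natr1; lra.
(* With B^2 = rho^2 / e, the ratio (B / rho)^(2dk) is exp(-dk). *)
set B := rho * expR (- 2^-1).
have B0 : 0 <= B by rewrite mulr_ge0 ?expR_ge0 // ltW.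
have B2 : B ^+ 2 = rho ^+ 2 / e.
  by rewrite exprMn -expRM_natl mulrN divff ?pnatr_eq0 // expRN.
have BX : B ^+ (d * k.*2) = (rho ^+ d) ^+ k.*2 * expR (- (d * k)%:R).
  rewrite exprMn exprM -expRM_natl; congr (_ * expR _).
  by rewrite -muln2 mulnA natrM; field.
have dev : Pr p (fun x => r < `|f x - Ex p f|) <= expR (- (d * k)%:R).
  have half : r / 2 = A * rho ^+ d by rewrite rE; field.
  have Arho : 0 < (A * rho ^+ d) ^+ k.*2 by rewrite exprn_gt0 // mulr_gt0 ?exprn_gt0.
  rewrite -(ler_pM2r Arho) -half.
  apply: le_trans (Pr_deviation_le E simpleE thV thE eta noField highT d a r B rho
    k r0 B0 (ltW rho0) _ _ _) _.
  - rewrite Vn -/s; apply: le_trans rho_ge; rewrite -subr_ge0.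
    have -> : 2 * e * d%:R * s - d%:R * s = (2 * e - 1) * (d%:R * s) by ring.
    apply: mulr_ge0; last exact: mulr_ge0 (ltW d0) (ltW s0).
    by rewrite subr_ge0 (le_trans e1) // mulr_natl mulr2n lerDl ltW.
  - by rewrite half.
  - rewrite Vn -/s B2 ler_pdivlMr // -muln2 !natrM.
    move: kt; rewrite ler_pdivlMr // => /(le_trans _) -> //.
    by rewrite le_eqVlt; apply/orP; left; apply/eqP; ring.
  by rewrite -/A BX half exprMn mulrA mulrC.
apply: (le_trans dev).
apply: (@le_trans _ _ (1 * expR (- (d * k)%:R))); first by rewrite mul1r.
rewrite ler_pM ?expR_ge0 ?ler1n // ler_expR lerN2.
have -> : powR r (2 / d%:R) = powR 2 (2 / d%:R) * powR A (2 / d%:R) * rho ^+ 2.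
  rewrite rE !powRM ?powX ?mulr_ge0 ?exprn_ge0 //; exact: ltW.
have q2 : powR 2 (2 / d%:R) <= 4 :> R.
  have -> : 4 = 2 `^ 2 :> R by rewrite (powR_mulrn 2) // -natrX.
  rewrite ler_powR ?ler1n // ler_pdivrMr // ler_peMr ?ler1n //.
have PA : 0 < powR A (2 / d%:R) by rewrite powR_gt0.
have -> : eta * (powR 2 (2 / d%:R) * powR A (2 / d%:R) * rho ^+ 2) /
    (16 * e / l * powR A (2 / d%:R) * n%:R * L) =
    (powR 2 (2 / d%:R) * l) * (rho ^+ 2 / (16 * e * s * L)).
  by rewrite /s; field; rewrite !gt_eqF.
(* Here 2^(2/d) <= 4 and l <= L are used; the result is d t / 2, at most d k. *)
apply: (@le_trans _ _ ((4 * L) * (rho ^+ 2 / (16 * e * s * L)))).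
  rewrite ler_wpM2r ?ler_pM ?powR_ge0 ?(ltW l0) //.
  apply: divr_ge0; first exact: sqr_ge0.
  by apply: mulr_ge0 (ltW L0); apply: mulr_ge0 (ltW s0); apply: mulr_ge0 (ltW e0).
have -> : 4 * L * (rho ^+ 2 / (16 * e * s * L)) = d%:R * (t / 2).
  by rewrite /t; field; rewrite !gt_eqF.
by rewrite natrM ler_wpM2l // ltW.
Qed.
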